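(* $$\frac{18}{-8+\pi^2}=\mathrm{CF}\left[5n^2+14n+10,\,-2n^3(2n+3)\right].$$
   Context: For sequences $(a_n)_{n\ge0}$, $(b_n)_{n\ge1}$, $\mathrm{CF}[a_n,b_n]$ denotes the continued fraction $a_0+\cfrac{b_1}{a_1+\cfrac{b_2}{a_2+\ddots}}$, whose value is $\lim_{n\to\infty}A_n/B_n$, where $A_0=1$, $A_1=a_0$, $B_0=0$, $B_1=1$, and $A_{n+1}=a_nA_n+b_nA_{n-1}$, $B_{n+1}=a_nB_n+b_nB_{n-1}$ for $n\ge1$. *)

(* Defs.v *)
From Stdlib Require Import Reals.
From Coquelicot Require Import Coquelicot.
Open Scope R_scope.

(* Sequences are indexed by all of nat; the value [b 0] is never used below. *)
Fixpoint cf_num (a b : nat -> R) (n : nat) : R :=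
  match n with
  | O => 1
  | S m =>
      match m with
      | O => a O
      | S k => a m * cf_num a b m + b m * cf_num a b k
      end
  end.

Fixpoint cf_den (a b : nat -> R) (n : nat) : R :=
  match n with
  | O => 0
  | S m =>
      match m with
      | O => 1
      | S k => a m * cf_den a b m + b m * cf_den a b k
      end
  end.

(* [cf_den a b 0 = 0] and real division is total, so the value of the continued
   fraction is only taken as meaningful when the denominators are eventually
   nonzero. *)
Definition is_CF (a b : nat -> R) (l : R) : Prop :=
  eventually (fun n => cf_den a b n <> 0) /\
  is_lim_seq (fun n => cf_num a b n / cf_den a b n) (Finite l).

(* Main.v *)
Require Import Defs.
From Stdlib Require Import Reals Factorial Lra Lia.
From Coquelicot Require Import Coquelicot.
Open Scope R_scope.

(** The numerators have the closed form [A_n = (2n+1)! (2n+3) / 3]. Summing the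
    Casoratian and telescoping gives, with [w_k = 1 / binom(2k,k)],
    [B_n / A_n = sum_(1 <= k <= n) w_k / k^2 - 4/9 + 4 w_n / (3 (2n+1) (2n+3))],
    so the value is the inverse of [pi^2/18 - 4/9]. The sum is twice the expansion
    of [arcsin^2] at [1/2]: the partial sums [F_n] of this expansion satisfy
    [(t^2 - F_n(sin t))'' = 2 w_n (2 sin t)^(2n)], which tends to [0] uniformly
    for [|t| <= pi/6]. *)

(** * Inverse central binomial coefficients *)

Definition inv_central_binom (n : nat) : R :=
  INR (fact n) ^ 2 / INR (fact (2 * n)).

Lemma INR_fact_S (n : nat) : INR (fact (S n)) = (INR n + 1) * INR (fact n).
Proof. now rewrite fact_simpl, mult_INR, S_INR. Qed.

Lemma INR_double (n : nat) : INR (2 * n) = 2 * INR n.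
Proof. now rewrite mult_INR. Qed.

Lemma inv_central_binom_S (n : nat) :
  inv_central_binom (S n) =
  inv_central_binom n * (INR n + 1) / (2 * (2 * INR n + 1)).
Proof.
unfold inv_central_binom.
replace (2 * S n)%nat with (S (S (2 * n))) by lia.
rewrite !INR_fact_S, S_INR, INR_double.
pose proof (pos_INR n); pose proof (INR_fact_neq_0 (2 * n)).
field; repeat split; lra.
Qed.

Lemma inv_central_binom_pos (n : nat) : 0 < inv_central_binom n.
Proof.
apply Rdiv_lt_0_compat; [apply pow_lt |]; apply INR_fact_lt_0.
Qed.

(** Each ratio (n+1) / (2 (2n+1)) is at most 1/2. *)
Lemma inv_central_binom_le (n : nat) : inv_central_binom n <= (/ 2) ^ n.
Proof.
induction n as [|n IH]; [unfold inv_central_binom; simpl; lra|].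
rewrite inv_central_binom_S; simpl.
pose proof (pos_INR n); pose proof (inv_central_binom_pos n) as Hw.
apply Rle_trans with (/ 2 * inv_central_binom n); [|lra].
apply Rmult_le_reg_r with (2 * (2 * INR n + 1)); [lra|].
field_simplify; nra.
Qed.

Lemma is_lim_seq_inv_central_binom : is_lim_seq inv_central_binom 0.
Proof.
apply is_lim_seq_le_le with (u := fun _ => 0) (w := fun n => (/ 2) ^ n).
- intros n; split; [left; apply inv_central_binom_pos | apply inv_central_binom_le].
- apply is_lim_seq_const.
- apply is_lim_seq_geom; rewrite Rabs_pos_eq; lra.
Qed.

(** * Partial sums of arcsin(s)^2 = sum_(n >= 1) (2s)^(2n) / (2 n^2 binom(2n,n)) *)

Definition arcsin_sq_coef (n : nat) : R :=
  4 ^ n * inv_central_binom n / (2 * INR n ^ 2).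

Fixpoint arcsin_sq_partial (n : nat) (s : R) : R :=
  match n with
  | O => 0
  | S m => arcsin_sq_partial m s + arcsin_sq_coef n * s ^ (2 * n)
  end.

Fixpoint arcsin_sq_partial_deriv (n : nat) (s : R) : R :=
  match n with
  | O => 0
  | S m => arcsin_sq_partial_deriv m s
           + arcsin_sq_coef n * (2 * INR n) * s ^ (2 * m + 1)
  end.

Lemma is_derive_arcsin_sq_partial_sin (n : nat) (t : R) :
  is_derive (fun t => arcsin_sq_partial n (sin t)) t
            (arcsin_sq_partial_deriv n (sin t) * cos t).
Proof.
induction n as [|n IH].
- simpl; rewrite Rmult_0_l; apply @is_derive_const.
- cbn [arcsin_sq_partial arcsin_sq_partial_deriv]; rewrite Rmult_plus_distr_r.
  apply @is_derive_plus; [exact IH|].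
  (* An opaque exponent lets [auto_derive] apply the power rule with [Nat.pred k]. *)
  remember (2 * S n)%nat as k eqn:Hk.
  auto_derive; [easy|]; subst k.
  replace (Nat.pred (2 * S n)) with (2 * n + 1)%nat by lia.
  rewrite INR_double.
  ring.
Qed.

(* The second derivative telescopes: [c_(k+1) (2k+2) (2k+1) = 4 k^2 c_k]. *)
Lemma is_derive_arcsin_sq_partial_deriv_sin (n : nat) (t : R) :
  is_derive (fun t => arcsin_sq_partial_deriv n (sin t) * cos t) t
            (2 - 2 * inv_central_binom n * (4 * sin t ^ 2) ^ n).
Proof.
induction n as [|n IH].
- apply is_derive_ext with (fun _ => 0); [intros; symmetry; apply Rmult_0_l|].
  replace (2 - 2 * inv_central_binom 0 * (4 * sin t ^ 2) ^ 0) with 0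
    by (unfold inv_central_binom; simpl; field).
  apply @is_derive_const.
- apply is_derive_ext with (fun t => arcsin_sq_partial_deriv n (sin t) * cos t
    + arcsin_sq_coef (S n) * (2 * INR (S n)) * (sin t ^ (2 * n + 1) * cos t)).
  { intros u; cbn [arcsin_sq_partial_deriv].
    rewrite Rmult_plus_distr_r, !Rmult_assoc; reflexivity. }
  (* The new summand is the derivative of sin^(2n+1) cos, with cos^2 written as 1 - sin^2: the
     identity left over is rational in x = sin^2 t and n, up to powers treated as symbols. *)
  replace (2 - 2 * inv_central_binom (S n) * (4 * sin t ^ 2) ^ S n) with
    ((2 - 2 * inv_central_binom n * (4 * sin t ^ 2) ^ n)
     + arcsin_sq_coef (S n) * (2 * INR (S n)) *
       ((2 * INR n + 1) * (sin t ^ 2) ^ n * (1 - sin t ^ 2)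
        - (sin t ^ 2) ^ n * sin t ^ 2)).
  + apply @is_derive_plus; [exact IH|].
    remember (2 * n + 1)%nat as k eqn:Hk.
    auto_derive; [easy|]; subst k.
    replace (Nat.pred (2 * n + 1)) with (2 * n)%nat by lia.
    rewrite plus_INR, INR_double, !pow_add, !pow_mult.
    replace (1 - sin t ^ 2) with (cos t ^ 2)
      by (pose proof (sin2_cos2 t); unfold Rsqr in *; nra).
    simpl INR; ring.
  + unfold arcsin_sq_coef.
    rewrite inv_central_binom_S, S_INR, !Rpow_mult_distr.
    pose proof (pos_INR n).
    generalize (sin t ^ 2); intros x.
    rewrite <- !(tech_pow_Rmult _ n).
    generalize (4 ^ n) (x ^ n); intros y z.
    field; lra.
Qed.

(** By monotonicity, [sin t] stays within 1/2 of 0. This keeps the factor (4 sin^2 t)^n of the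
    second derivative at most 1. *)
Lemma sin_sq_le_quarter (t : R) : Rabs t <= PI / 6 -> 4 * sin t ^ 2 <= 1.
Proof.
intros Ht; apply Rabs_le_between in Ht.
pose proof PI_RGT_0; pose proof sin_PI6 as H6.
assert (sin t <= 1 / 2) by (rewrite <- H6; apply sin_incr_1; lra).
assert (- (1 / 2) <= sin t)
  by (rewrite <- H6, <- sin_neg; apply sin_incr_1; lra).
nra.
Qed.

(** The remainder and its first derivative vanish at 0, and its second derivative is bounded by 2
    w_n. The mean value inequality is applied twice; each time the factor |t| is dropped, since
    [PI <= 4] gives |t| < 1. *)
Lemma arcsin_sq_partial_remainder (n : nat) (t : R) :
  Rabs t <= PI / 6 ->
  Rabs (t ^ 2 - arcsin_sq_partial n (sin t)) <= 2 * inv_central_binom n.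
Proof.
set (M := 2 * inv_central_binom n).
assert (HM : 0 < M) by (pose proof (inv_central_binom_pos n); unfold M; lra).
pose proof PI_4 as Hpi.
set (g := fun t => t ^ 2 - arcsin_sq_partial n (sin t)).
set (g' := fun t => 2 * t - arcsin_sq_partial_deriv n (sin t) * cos t).
assert (Hg0 : g 0 = 0).
{ unfold g; rewrite sin_0; clear; induction n as [|n IH]; simpl in *; lra. }
assert (Hg'0 : g' 0 = 0).
{ unfold g'; rewrite sin_0, cos_0; clear.
  induction n as [|n IH]; [simpl; ring|].
  cbn [arcsin_sq_partial_deriv].
  rewrite pow_i by lia; lra. }
assert (Hg' : forall t, Rabs t <= PI / 6 -> Rabs (g' t) <= M).
{ intros u Hu.
  replace (g' u) with (g' u - g' 0) by lra.
  apply Rle_trans with (M * Rabs (u - 0)); [|rewrite Rminus_0_r; nra].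
  apply bounded_variation with (dh := fun v => M * (4 * sin v ^ 2) ^ n).
  intros v Hv; rewrite !Rminus_0_r in Hv; split.
  - replace (M * (4 * sin v ^ 2) ^ n) with
      (2 - (2 - 2 * inv_central_binom n * (4 * sin v ^ 2) ^ n)) by (unfold M; ring).
    apply @is_derive_minus; [auto_derive; [easy | ring]|].
    apply is_derive_arcsin_sq_partial_deriv_sin.
  - assert (H4 : 0 <= 4 * sin v ^ 2 <= 1).
    { split; [nra | apply sin_sq_le_quarter; lra]. }
    pose proof (pow_le _ n (proj1 H4)); pose proof (pow_incr _ _ n H4) as H1.
    rewrite pow1 in H1.
    rewrite Rabs_pos_eq; nra. }
intros Ht; change (Rabs (g t) <= M).
replace (g t) with (g t - g 0) by lra.
apply Rle_trans with (M * Rabs (t - 0)); [|rewrite Rminus_0_r; nra].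
apply bounded_variation with (dh := g').
intros v Hv; rewrite !Rminus_0_r in Hv; split; [|apply Hg'; lra].
apply @is_derive_minus; [auto_derive; [easy | ring]|].
apply is_derive_arcsin_sq_partial_sin.
Qed.

(** The remainder bound is taken at t = pi/6, where sin t = 1/2 and t^2 = pi^2/36. *)
Lemma is_lim_seq_arcsin_sq_partial_half :
  is_lim_seq (fun n => arcsin_sq_partial n (1 / 2)) (PI ^ 2 / 36).
Proof.
pose proof PI_RGT_0.
assert (H6 : Rabs (PI / 6) <= PI / 6) by (rewrite Rabs_pos_eq; lra).
apply is_lim_seq_le_le with
  (u := fun n => PI ^ 2 / 36 - 2 * inv_central_binom n)
  (w := fun n => PI ^ 2 / 36 + 2 * inv_central_binom n).
- intros n; pose proof (arcsin_sq_partial_remainder n _ H6) as Hr.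
  rewrite sin_PI6 in Hr; apply Rabs_le_between in Hr; nra.
- replace (PI ^ 2 / 36) with (PI ^ 2 / 36 - 2 * 0) at 1 by ring.
  apply is_lim_seq_minus'; [apply is_lim_seq_const|].
  apply (is_lim_seq_scal_l _ 2 0), is_lim_seq_inv_central_binom.
- replace (PI ^ 2 / 36) with (PI ^ 2 / 36 + 2 * 0) at 1 by ring.
  apply is_lim_seq_plus'; [apply is_lim_seq_const|].
  apply (is_lim_seq_scal_l _ 2 0), is_lim_seq_inv_central_binom.
Qed.

Lemma arcsin_sq_partial_half_S (n : nat) :
  arcsin_sq_partial (S n) (1 / 2) =
  arcsin_sq_partial n (1 / 2)
  + inv_central_binom (S n) / (2 * (INR n + 1) ^ 2).
Proof.
cbn [arcsin_sq_partial]; unfold arcsin_sq_coef.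
rewrite pow_mult, S_INR.
replace ((1 / 2) ^ 2) with (/ 4) by field.
rewrite pow_inv; pose proof (pos_INR n).
field; split; [lra | apply pow_nonzero; lra].
Qed.

(** The first term is 1/4 and the others are positive. Twice this bound exceeds 4/9, which makes
    [inv_convergent] positive. *)
Lemma arcsin_sq_partial_half_ge (n : nat) :
  1 / 4 <= arcsin_sq_partial (S n) (1 / 2).
Proof.
induction n as [|n IH].
- unfold arcsin_sq_partial, arcsin_sq_coef, inv_central_binom; simpl; lra.
- rewrite arcsin_sq_partial_half_S.
  assert (0 < inv_central_binom (S (S n)) / (2 * (INR (S n) + 1) ^ 2)); [|lra].
  apply Rdiv_lt_0_compat; [apply inv_central_binom_pos|].
  pose proof (pos_INR (S n)); nra.
Qed.

(** * Closed forms of numerators and denominators *)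

Definition cf_a (n : nat) : R := 5 * INR n ^ 2 + 14 * INR n + 10.
Definition cf_b (n : nat) : R := - 2 * INR n ^ 3 * (2 * INR n + 3).

Definition num_closed (n : nat) : R :=
  INR (fact (2 * n + 1)) * (2 * INR n + 3) / 3.

(** The quotient B_n / A_n; the constant 4/9 makes it vanish at n = 0, in accordance with B_0 =
    0. *)
Definition inv_convergent (n : nat) : R :=
  2 * arcsin_sq_partial n (1 / 2) - 4 / 9
  + 4 * inv_central_binom n / (3 * (2 * INR n + 1) * (2 * INR n + 3)).

Lemma num_closed_S (n : nat) :
  num_closed (S n) =
  (2 * INR n + 2) * (2 * INR n + 5) * num_closed n.
Proof.
unfold num_closed.
replace (2 * S n + 1)%nat with (S (S (2 * n + 1))) by lia.
rewrite !INR_fact_S, !S_INR, plus_INR, INR_double; simpl; field.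
Qed.

Lemma num_closed_pos (n : nat) : 0 < num_closed n.
Proof.
pose proof (pos_INR n); pose proof (INR_fact_lt_0 (2 * n + 1)).
unfold num_closed; nra.
Qed.

Lemma inv_convergent_pos (n : nat) : 0 < inv_convergent (S n).
Proof.
unfold inv_convergent.
pose proof (arcsin_sq_partial_half_ge n).
assert (0 < 4 * inv_central_binom (S n)
            / (3 * (2 * INR (S n) + 1) * (2 * INR (S n) + 3))); [|lra].
pose proof (pos_INR (S n)); pose proof (inv_central_binom_pos (S n)).
apply Rdiv_lt_0_compat; nra.
Qed.

(** The increment is the Casoratian A_n B_(n+1) - A_(n+1) B_n = prod_(1 <= k <= n) 2 k^3 (2k+3),
    divided by A_n A_(n+1). *)
Lemma inv_convergent_S (n : nat) :
  inv_convergent (S n) =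
  inv_convergent n
  + 3 * inv_central_binom (S n)
    / ((INR n + 1) ^ 2 * (2 * INR n + 3) * (2 * INR n + 5)).
Proof.
unfold inv_convergent.
rewrite arcsin_sq_partial_half_S, inv_central_binom_S, S_INR.
pose proof (pos_INR n); field; lra.
Qed.

Lemma cf_num_closed (n : nat) : cf_num cf_a cf_b n = num_closed n.
Proof.
(* The recurrence has order two, so the induction carries two consecutive values. *)
enough (H : cf_num cf_a cf_b n = num_closed n
            /\ cf_num cf_a cf_b (S n) = num_closed (S n)) by apply H.
induction n as [|n [IH0 IH1]].
- split; [unfold num_closed | unfold num_closed, cf_a]; simpl; field.
- split; [exact IH1|].
  change (cf_num cf_a cf_b (S (S n))) with
    (cf_a (S n) * cf_num cf_a cf_b (S n) + cf_b (S n) * cf_num cf_a cf_b n).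
  rewrite IH0, IH1; unfold cf_a, cf_b.
  rewrite !num_closed_S, !S_INR; ring.
Qed.

Lemma cf_den_closed (n : nat) :
  cf_den cf_a cf_b n = num_closed n * inv_convergent n.
Proof.
enough (H : cf_den cf_a cf_b n = num_closed n * inv_convergent n
            /\ cf_den cf_a cf_b (S n) = num_closed (S n) * inv_convergent (S n))
  by apply H.
induction n as [|n [IH0 IH1]].
- rewrite inv_convergent_S, num_closed_S, inv_central_binom_S.
  unfold inv_convergent, inv_central_binom, num_closed.
  simpl; split; field.
- split; [exact IH1|].
  change (cf_den cf_a cf_b (S (S n))) with
    (cf_a (S n) * cf_den cf_a cf_b (S n) + cf_b (S n) * cf_den cf_a cf_b n).
  rewrite IH0, IH1; unfold cf_a, cf_b.
  (* All terms are reduced to index n, which leaves a rational identity in n and the three values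
     there. *)
  rewrite !inv_convergent_S, !num_closed_S, !inv_central_binom_S, !S_INR.
  pose proof (pos_INR n); field; lra.
Qed.

(** * Passage to the limit *)

Lemma is_lim_seq_inv_convergent :
  is_lim_seq inv_convergent ((PI ^ 2 - 8) / 18).
Proof.
replace ((PI ^ 2 - 8) / 18) with (2 * (PI ^ 2 / 36) - 4 / 9 + 0) by field.
apply is_lim_seq_plus'.
- apply is_lim_seq_minus'; [|apply is_lim_seq_const].
  apply (is_lim_seq_scal_l _ 2 (PI ^ 2 / 36)), is_lim_seq_arcsin_sq_partial_half.
- apply is_lim_seq_le_le with
    (u := fun _ => 0) (w := fun n => 2 * inv_central_binom n).
  + intros n; pose proof (pos_INR n); pose proof (inv_central_binom_pos n).
    assert (Hd : 9 <= 3 * (2 * INR n + 1) * (2 * INR n + 3)) by nra.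
    split.
    * apply Rlt_le, Rdiv_lt_0_compat; lra.
    * apply Rle_div_l; nra.
  + apply is_lim_seq_const.
  + replace 0 with (2 * 0) by ring.
    apply (is_lim_seq_scal_l _ 2 0), is_lim_seq_inv_central_binom.
Qed.

Theorem theorem3p1 :
  is_CF (fun n : nat => 5 * INR n ^ 2 + 14 * INR n + 10)
        (fun n : nat => - 2 * INR n ^ 3 * (2 * INR n + 3))
        (18 / (- 8 + PI ^ 2)).
Proof.
change (is_CF cf_a cf_b (18 / (- 8 + PI ^ 2))).
(* [PI2_3_2] amounts to pi > 3, hence pi^2 > 9. *)
assert (Hpi : 0 < PI ^ 2 - 8) by (pose proof PI2_3_2; nra).
split.
- exists 1%nat; intros [|n] Hn; [lia|].
  rewrite cf_den_closed.
  pose proof (num_closed_pos (S n)); pose proof (inv_convergent_pos n); nra.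
(* The common factor [num_closed n] cancels; index 0 is excluded because B_0 = 0. *)
- apply is_lim_seq_ext_loc with (fun n => / inv_convergent n).
  + exists 1%nat; intros [|n] Hn; [lia|].
    rewrite cf_den_closed, cf_num_closed.
    pose proof (num_closed_pos (S n)); pose proof (inv_convergent_pos n).
    field; lra.
  + replace (Finite (18 / (- 8 + PI ^ 2)))
      with (Rbar_inv ((PI ^ 2 - 8) / 18)) by (simpl; f_equal; field; lra).
    apply is_lim_seq_inv; [exact is_lim_seq_inv_convergent|].
    intros E; injection E; lra.
Qed.
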